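(* Let $d\ge 1$, let $C\subset\mathbb{R}^n$ be nonempty and convex, let $\bar{x}\in C$, let $\alpha\in(0,1]$, and let $f\in\mathcal{C}^d_{\mathrm{abs}}(\mathbb{R}^n)$ be abs-smooth with abs-linearization $\Delta f(\bar{x};\cdot)$ at $\bar{x}$. Suppose that $$\max_{v\in C}\frac{-\Delta f(\bar{x};\alpha(v-\bar{x}))}{\alpha}=0$$ (the maximum is attained and equals $0$). Then $f$ is first-order minimal at $\bar{x}$ over $C$, i.e., for every $v\in C$, $f'(\bar{x};v-\bar{x})\geq 0$. In particular, if $\min_{v\in C}\Delta f(\bar{x};v-\bar{x})=0$, then $f$ is first-order minimal at $\bar{x}$ over $C$.
   Context: Abs-smooth functions: for $d\in\mathbb{N}$, $\mathcal{C}^d_{\mathrm{abs}}(\mathbb{R}^n)$ is the set of locally Lipschitz continuous functions $f:\mathbb{R}^n\to\mathbb{R}$, $y=f(x)$, given by an abs-smooth form $z=F(x,z,|z|)$, $y=\varphi(x,z)$, where $F\in\mathcal{C}^d(\mathbb{R}^{n+s+s},\mathbb{R}^s)$, $\varphi\in\mathcal{C}^d(\mathbb{R}^{n+s},\mathbb{R})$, $|z|$ is componentwise, and $z_i$ is determined only by $x$ and the values $z_j$, $1\le j<i$ (so the $i$-th component of $F(x,z,w)$ depends only on $x$ and on $z_j,w_j$ with $j<i$, and $z=z(x)$ is uniquely determined by $x$). The components of $z$ are called switching variables. For $d\ge1$, $f\in\mathcal{C}^d_{\mathrm{abs}}(\mathbb{R}^n)$ is called abs-smooth. One such representation of $f$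 is fixed. Abs-linearization: at $\bar{x}\in\mathbb{R}^n$, let $\bar z=z(\bar x)$ and, with $w$ denoting the third argument of $F$, set $Z=\partial_xF$, $M=\partial_zF$, $L=\partial_wF$ evaluated at $(\bar x,\bar z,|\bar z|)$ ($M,L$ are strictly lower triangular), and $a=\partial_x\varphi$, $b=\partial_z\varphi$ evaluated at $(\bar x,\bar z)$. For $\Delta x\in\mathbb{R}^n$ let $\Delta z$ be the unique solution of $\Delta z=Z\Delta x+M\Delta z+L(|\bar z+\Delta z|-|\bar z|)$. Then $\Delta f(\bar x;\Delta x)=a^\top\Delta x+b^\top\Delta z$. This is a piecewise linear function of $\Delta x$. $f'(\bar x;h)$ denotes the (one-sided) directional derivative $\lim_{\tau\downarrow0}(f(\bar x+\tau h)-f(\bar x))/\tau$, which exists for every $h\in\mathbb{R}^n$ for abs-smooth $f$. *)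

(* Defs.v *)
From HB Require Import structures.
From mathcomp Require Import all_boot all_order all_algebra.
From mathcomp Require Import all_classical all_reals all_analysis.

Set Implicit Arguments.
Unset Strict Implicit.
Unset Printing Implicit Defensive.

Import Order.TTheory GRing.Theory Num.Theory.
Import numFieldNormedType.Exports.

Local Open Scope classical_set_scope.
Local Open Scope ring_scope.

(* Vectors are rows, so a matrix acts on the right: "dx *m Z" stands for the
   product Z dx of the column convention, and 'J is the transposed Jacobian. *)

(* [Ck d f] is f \in C^d.  In finite dimension, continuity of the differential
   amounts to continuity of all the directional derivatives. *)
Fixpoint Ck (R : realType) (V W : normedModType R) (d : nat) (f : V -> W)
    : Prop :=
  if d is d'.+1 then
    (forall x : V, differentiable f x) /\ (forall v : V, Ck d' (fun x => 'D_v f x))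
  else continuous f.

Definition locally_lipschitz (R : realType) (V W : normedModType R)
    (f : V -> W) : Prop :=
  forall x : V, exists2 U : set V, nbhs x U & [lipschitz f y | y in U].

Definition rvabs (R : realType) (s : nat) (z : 'rV[R]_s) : 'rV[R]_s :=
  map_mx (fun t => `|t|) z.

(* The i-th component of F(x, z, w) only depends on x and on z_j, w_j, j < i. *)
Definition strictly_triangular (R : realType) (n s : nat)
    (F : 'rV[R]_n * 'rV[R]_s * 'rV[R]_s -> 'rV[R]_s) : Prop :=
  forall (x : 'rV[R]_n) (z z' w w' : 'rV[R]_s) (i : 'I_s),
    (forall j : 'I_s, (j < i)%N ->
       z ord0 j = z' ord0 j /\ w ord0 j = w' ord0 j) ->
    F (x, z, w) ord0 i = F (x, z', w') ord0 i.

(* A solution of z = G z, with junk value 0 if there is none; see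
   [switchingP] and [delta_zP] for existence and uniqueness. *)
Definition solution (R : realType) (s : nat) (G : 'rV[R]_s -> 'rV[R]_s)
    : 'rV[R]_s :=
  xget 0 [set z | z = G z].

Definition switching (R : realType) (n s : nat)
    (F : 'rV[R]_n * 'rV[R]_s * 'rV[R]_s -> 'rV[R]_s) (x : 'rV[R]_n)
    : 'rV[R]_s :=
  solution (fun z => F (x, z, rvabs z)).

Definition abs_smooth_form (R : realType) (d n s : nat) (f : 'rV[R]_n -> R)
    (F : 'rV[R]_n * 'rV[R]_s * 'rV[R]_s -> 'rV[R]_s)
    (phi : 'rV[R]_n * 'rV[R]_s -> R) : Prop :=
  [/\ Ck d F, Ck d phi, strictly_triangular F &
      forall x, f x = phi (x, switching F x)].

Definition Cabs (R : realType) (d n : nat) : set ('rV[R]_n -> R) :=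
  [set f | locally_lipschitz f /\
           exists s (F : 'rV[R]_n * 'rV[R]_s * 'rV[R]_s -> 'rV[R]_s)
                    (phi : 'rV[R]_n * 'rV[R]_s -> R),
             abs_smooth_form d f F phi].

Definition grad (R : realType) (n : nat) (g : 'rV[R]_n -> R) (x : 'rV[R]_n)
    : 'cV[R]_n :=
  \col_i 'D_(delta_mx ord0 i) g x.

Section AbsLinearization.
Variables (R : realType) (n s : nat).
Variable F : 'rV[R]_n * 'rV[R]_s * 'rV[R]_s -> 'rV[R]_s.
Variable phi : 'rV[R]_n * 'rV[R]_s -> R.
Variable xbar : 'rV[R]_n.

Let zbar : 'rV[R]_s := switching F xbar.

Definition Zmat : 'M[R]_(n, s) := 'J (fun x => F (x, zbar, rvabs zbar)) xbar.
Definition Mmat : 'M[R]_s := 'J (fun z => F (xbar, z, rvabs zbar)) zbar.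
Definition Lmat : 'M[R]_s := 'J (fun w => F (xbar, zbar, w)) (rvabs zbar).
Definition avec : 'cV[R]_n := grad (fun x => phi (x, zbar)) xbar.
Definition bvec : 'cV[R]_s := grad (fun z => phi (xbar, z)) zbar.

Definition delta_z_rhs (dx : 'rV[R]_n) (dz : 'rV[R]_s) : 'rV[R]_s :=
  dx *m Zmat + dz *m Mmat + (rvabs (zbar + dz) - rvabs zbar) *m Lmat.

Definition delta_z (dx : 'rV[R]_n) : 'rV[R]_s := solution (delta_z_rhs dx).

Definition delta_f (dx : 'rV[R]_n) : R :=
  (dx *m avec + delta_z dx *m bvec) ord0 ord0.

End AbsLinearization.

Definition diff_quot (R : realType) (n : nat) (f : 'rV[R]_n -> R)
    (x h : 'rV[R]_n) : R -> R :=
  fun tau => (f (x + tau *: h) - f x) / tau.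

Definition dir_deriv (R : realType) (n : nat) (f : 'rV[R]_n -> R)
    (x h : 'rV[R]_n) : R :=
  lim (diff_quot f x h tau @[tau --> 0^'+]).

(* [lim] is a junk value on divergent filters, hence the [cvg] conjunct. *)
Definition first_order_minimal (R : realType) (n : nat) (f : 'rV[R]_n -> R)
    (C : set 'rV[R]_n) (x : 'rV[R]_n) : Prop :=
  forall v, C v ->
    cvg (diff_quot f x (v - x) tau @[tau --> 0^'+]) /\
    0 <= dir_deriv f x (v - x).

Definition is_max_over (R : realType) (T : Type) (A : set T) (g : T -> R)
    (m : R) : Prop :=
  (g @` A) m /\ ubound (g @` A) m.

Definition is_min_over (R : realType) (T : Type) (A : set T) (g : T -> R)
    (m : R) : Prop :=
  (g @` A) m /\ lbound (g @` A) m.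

Section WellDefined.
Variables (R : realType).

Lemma triangular_solution (s : nat) (G : 'rV[R]_s -> 'rV[R]_s) :
  (forall (z z' : 'rV[R]_s) (i : 'I_s),
    (forall j : 'I_s, (j < i)%N -> z ord0 j = z' ord0 j) ->
    G z ord0 i = G z' ord0 i) ->
  solution G = G (solution G) /\ forall z, z = G z -> z = solution G.
Proof.
move=> GT.
have iterE k m (i : 'I_s) : (i < k)%N -> (k <= m)%N ->
    iter m G 0 ord0 i = iter k G 0 ord0 i.
  elim: k m i => // k IH [//|m] i ik km /=.
  apply: GT => j ji; rewrite (IH m j) //.
  exact: leq_trans ji ik.
have ex : iter s G 0 = G (iter s G 0).
  by apply/rowP => i; rewrite -(iterE s s.+1 i).
have uniq z z' : z = G z -> z' = G z' -> z = z'.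
  move=> zE z'E; apply/rowP => i.
  have [k] := ubnP (nat_of_ord i); elim: k i => // k IH i ik.
  rewrite zE z'E; apply: GT => j ji; apply: IH.
  exact: leq_trans ji ik.
have sP : solution G = G (solution G).
  exact: (xgetPex 0 (ex_intro [set z | z = G z] _ ex)).
by split => // z zE; exact: uniq.
Qed.

Lemma switchingP (n s : nat)
    (F : 'rV[R]_n * 'rV[R]_s * 'rV[R]_s -> 'rV[R]_s) (x : 'rV[R]_n) :
  strictly_triangular F ->
  switching F x = F (x, switching F x, rvabs (switching F x)) /\
  forall z, z = F (x, z, rvabs z) -> z = switching F x.
Proof.
move=> FT; apply: triangular_solution => z z' i zz'.
by apply: FT => j ji; rewrite !mxE zz'.
Qed.

Lemma jacobian_triangular (s : nat) (G : 'rV[R]_s -> 'rV[R]_s)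
    (p u u' : 'rV[R]_s) (i : 'I_s) :
  differentiable G p ->
  (forall z z' : 'rV[R]_s, (forall j : 'I_s, (j < i)%N ->
     z ord0 j = z' ord0 j) -> G z ord0 i = G z' ord0 i) ->
  (forall j : 'I_s, (j < i)%N -> u ord0 j = u' ord0 j) ->
  (u *m 'J G p) ord0 i = (u' *m 'J G p) ord0 i.
Proof.
move=> dG GT uu'; apply/eqP; rewrite -subr_eq0; apply/eqP.
have -> : (u *m 'J G p) ord0 i - (u' *m 'J G p) ord0 i =
    ((u - u') *m 'J G p) ord0 i by rewrite mulmxBl !mxE.
rewrite -deriveEjacobian //.
have E h : (h^-1 *: (G (h *: (u - u') + p) - G p)) ord0 i = 0.
  rewrite !mxE (GT _ p) ?subrr ?mulr0 // => j ji.
  by rewrite !mxE uu' // subrr mulr0 add0r.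
have dv : derivable G p (u - u') by exact: diff_derivable.
have /cvg_ex[/= l hl] := dv.
have -> : 'D_(u - u') G p = l by exact: cvg_lim.
have hli : (h^-1 *: (G (h *: (u - u') + p) - G p)) ord0 i @[h --> 0^'] -->
    l ord0 i.
  exact: (cvg_comp _ _ hl (@coord_continuous _ _ _ ord0 i l)).
apply: (cvg_unique _ hli) => //.
rewrite (_ : (fun h : R => _) = cst 0); last exact/funext.
exact: cvg_cst.
Qed.

Lemma delta_zP (d n s : nat) (f : 'rV[R]_n -> R)
    (F : 'rV[R]_n * 'rV[R]_s * 'rV[R]_s -> 'rV[R]_s)
    (phi : 'rV[R]_n * 'rV[R]_s -> R) (xbar dx : 'rV[R]_n) :
  (0 < d)%N -> abs_smooth_form d f F phi ->
  delta_z F xbar dx = delta_z_rhs F xbar dx (delta_z F xbar dx) /\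
  forall dz, dz = delta_z_rhs F xbar dx dz -> dz = delta_z F xbar dx.
Proof.
case: d => // d _ [[dF _] _ FT _].
apply: triangular_solution => z z' i zz'.
have add_coord (c A A' B B' : 'rV[R]_s) : A ord0 i = A' ord0 i ->
    B ord0 i = B' ord0 i -> (c + A + B) ord0 i = (c + A' + B') ord0 i.
  by rewrite !mxE => -> ->.
apply: add_coord; apply: jacobian_triangular.
- apply: (@differentiable_comp _ _ _ _
    (fun z => (xbar, z, rvabs (switching F xbar))) F); last exact: dF.
  by apply: differentiable_pair => //; exact: differentiable_pair.
- by move=> y y' yy'; apply: FT => j ji; rewrite yy'.
- exact: zz'.
- apply: (@differentiable_comp _ _ _ _
    (fun w => (xbar, switching F xbar, w)) F); last exact: dF.
  by apply: differentiable_pair.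
- by move=> y y' yy'; apply: FT => j ji; rewrite yy'.
- by move=> j ji; rewrite !mxE zz'.
Qed.

End WellDefined.

(* Main.v *)
Require Import Defs.
From mathcomp Require Import all_boot all_order all_algebra.
From mathcomp Require Import all_classical all_reals all_analysis.

Import Order.TTheory GRing.Theory Num.Theory.
Import numFieldNormedType.Exports.

Local Open Scope classical_set_scope.
Local Open Scope ring_scope.

(** The theorem holds because the abs-linearization is exact to first order
along rays, and even homogeneous there for small steps: with h fixed,
Delta f(xbar; tau h) = tau * f'(xbar; h) for all small tau > 0
([abs_linearization_ray]).  Given v in C, convexity lets the hypothesis be
applied to the point xbar + (tau / alpha) (v - xbar) of C instead of v; it
says that Delta f(xbar; tau (v - xbar)) >= 0, and dividing by tau gives
f'(xbar; v - xbar) >= 0.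

The homogeneity is a comparison of two fixed-point equations.  A curve with
a one-sided tangent at 0 ([right_tangent]) is sent to such a curve by every
differentiable map ([right_tangent_comp]) and by the componentwise absolute
value ([right_tangent_rvabs]).  The switching vector z(xbar + tau h) is
reached by finitely many substitutions into F, because F is triangular; hence
it has a one-sided tangent u ([right_tangent_switching]).  Differentiating
z = F(x, z, |z|) along the ray gives u = Z h + M u + L |.|'(zbar; u).  As the
absolute value is affine on short rays ([rvabs_ray]), multiplying by a small
tau turns this into the equation that defines Delta z(tau h), so
Delta z(tau h) = tau u by uniqueness of its solution. *)

Set Implicit Arguments.
Unset Strict Implicit.
Unset Printing Implicit Defensive.

(** * One-sided tangents of curves *)

(** With p = c 0 this is the right derivative of c at 0.  The base point is a
    separate argument so that it can be given in a form that is only provably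
    equal to [c 0]. *)
Definition right_tangent (R : realType) (V : normedModType R)
    (c : R -> V) (p v : V) : Prop :=
  tau^-1 *: (c tau - p) @[tau --> 0^'+] --> v.

Section RightTangent.
Context (R : realType).

Lemma right_tangent_unique (V : normedModType R) (c : R -> V) (p v w : V) :
  right_tangent c p v -> right_tangent c p w -> v = w.
Proof. by move=> cv cw; apply: cvg_unique cv cw; exact: norm_hausdorff. Qed.

Lemma right_tangent_affine (V : normedModType R) (p v : V) :
  right_tangent (fun tau => p + tau *: v) p v.
Proof.
rewrite /right_tangent; apply: cvg_near_cst; near=> tau.
by rewrite addrC addKr scalerA mulVf ?scale1r// gt_eqF.
Unshelve. all: by end_near. Qed.

Lemma right_tangent_pair (V W : normedModType R) (c : R -> V) (e : R -> W)
    (p v : V) (q w : W) :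
  right_tangent c p v -> right_tangent e q w ->
  right_tangent (fun tau => (c tau, e tau)) (p, q) (v, w).
Proof. by move=> cv ew; apply: cvg_pair. Qed.

Lemma right_tangent_cvg0 (V : normedModType R) (c : R -> V) (p v : V) :
  right_tangent c p v -> (c tau - p) @[tau --> 0^'+] --> 0.
Proof.
move=> cv; have tau0 : tau @[tau --> (0 : R)^'+] --> (0 : R).
  by apply: cvg_at_right_filter; exact: cvg_id.
have := cvgZ tau0 cv; rewrite scale0r => cv0; refine (cvg_trans _ (cv0 _)).
apply: near_eq_cvg; near=> tau.
by rewrite /= scalerA mulfV ?scale1r// gt_eqF.
Unshelve. all: by end_near. Qed.

(** The difference quotients of c only converge to v, so the directional
    derivative of G along v says nothing about G on c by itself; the Frechet
    expansion of G at p is uniform in the direction.  Its remainder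
    o(c tau - p) / tau vanishes because (c tau - p) / tau stays bounded. *)
Lemma right_tangent_comp (V W : normedModType R) (G : V -> W)
    (c : R -> V) (p v : V) :
  differentiable G p -> right_tangent c p v ->
  right_tangent (G \o c) (G p) ('d G p v).
Proof.
move=> dG cv; rewrite /right_tangent /=.
have [dGc GE] := (diff_locallyxP p G).1 dG.
pose o h := G (h + p) - G p - 'd G p h.
have oP e : 0 < e -> \forall h \near (0 : V), `|o h| <= e * `|h|.
  move=> e0; near=> h.
  rewrite /o GE -(addrA _ (- G p)) -opprD addrC addKr.
  by near: h; exact: littleoP.
have -> : (fun tau => tau^-1 *: (G (c tau) - G p)) =
    (fun tau => 'd G p (tau^-1 *: (c tau - p)) + tau^-1 *: o (c tau - p)).
  apply/funext => tau.
  by rewrite linearZ /= -scalerDr /o /= subrK addrCA subrr addr0.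
rewrite -[X in _ --> X]addr0; apply: cvgD.
  exact: continuous_cvg (dGc _) cv.
apply/cvgr0Pnorm_le => e e0.
(* The quotients (c tau - p) / tau are eventually bounded by `|v| + 1, so a
   remainder of relative size e / (`|v| + 1) is enough. *)
have v1 : 0 < `|v| + 1 by rewrite ltr_wpDl.
have cvo := right_tangent_cvg0 cv (oP _ (divr_gt0 e0 v1)).
near=> tau.
have t0 : 0 < tau by near: tau; exact: nbhs_right_gt.
have ho : `|o (c tau - p)| <= e / (`|v| + 1) * `|c tau - p|.
  by near: tau; exact: cvo.
have hv : `|tau^-1 *: (c tau - p)| <= `|v| + 1.
  by near: tau; apply: (cvgr_norm_le _ cv); rewrite ltrDl.
rewrite normrZ; apply: (le_trans (ler_wpM2l _ ho)) => //.
rewrite mulrCA -normrZ -ler_pdivlMl ?divr_gt0// invfM invrK.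
by rewrite mulrAC mulVf ?gt_eqF// mul1r.
Unshelve. all: by end_near. Qed.

(** * The componentwise absolute value along a ray *)

(** The one-sided directional derivative of [rvabs] at z in the direction u. *)
Definition abs_dir_deriv (s : nat) (z u : 'rV[R]_s) : 'rV[R]_s :=
  \row_i (if z ord0 i == 0 then `|u ord0 i| else Num.sg (z ord0 i) * u ord0 i).

(** An equality, not an estimate: each nonzero coordinate of z keeps its sign
    for small tau, and a zero coordinate contributes tau * `|u_i|.  This is
    what makes the abs-linearization homogeneous for small steps. *)
Lemma rvabs_ray (s : nat) (z u : 'rV[R]_s) :
  \forall tau \near 0^'+,
    rvabs (z + tau *: u) - rvabs z = tau *: abs_dir_deriv z u.
Proof.
have H (i : 'I_s) : \forall tau \near (0:R)^'+,
    `|z ord0 i + tau * u ord0 i| - `|z ord0 i| =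
      tau * abs_dir_deriv z u ord0 i.
  rewrite mxE; have [->|z0] := eqVneq.
    near=> tau.
    by rewrite add0r normr0 subr0 normrM gtr0_norm.
  (* The quotient `|z_i| / (`|u_i| + 1) is a step length below which z_i keeps
     its sign; adding 1 covers u_i = 0. *)
  have u1 : 0 < `|u ord0 i| + 1 by rewrite ltr_wpDl.
  near=> tau.
  have t0 : 0 < tau by [].
  have tu : `|tau * u ord0 i| < `|z ord0 i|.
    rewrite normrM gtr0_norm//.
    apply: (@le_lt_trans _ _ (tau * (`|u ord0 i| + 1))).
      by rewrite ler_pM2l// lerDl.
    rewrite -ltr_pdivlMr//; near: tau; apply: nbhs_right_lt.
    by rewrite divr_gt0// normr_gt0.
  move: tu; rewrite ltr_norml => /andP[].
  have [zp|zn|zz] := ltrgt0P (z ord0 i) => tu1 tu2.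
  - rewrite gtr0_sg// gtr0_norm ?mul1r; first by rewrite addrC addKr.
    by rewrite -ltrBlDl sub0r.
  - rewrite ltr0_sg// ltr0_norm ?mulN1r ?mulrN.
      by rewrite opprD opprK addrAC addNr add0r.
    by rewrite -ltrBrDl sub0r.
  - by have := z0; rewrite zz eqxx.
have /filterS : \forall tau \near (0:R)^'+, forall i : 'I_s,
    `|z ord0 i + tau * u ord0 i| - `|z ord0 i| =
      tau * abs_dir_deriv z u ord0 i.
  exact: filter_forall.
apply => tau Ht; apply/rowP => i; move: (Ht i).
by rewrite /rvabs !mxE.
Unshelve. all: by end_near. Qed.

Lemma ler_dist_rvabs (s : nat) (y z : 'rV[R]_s) :
  `|rvabs y - rvabs z| <= `|y - z|.
Proof.
rewrite /Num.norm /= !mx_normrE; apply: bigmax_le => [|ij _].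
  exact: bigmax_ge_id.
apply: le_trans (le_bigmax _ (fun ij => `|(y - z) ij.1 ij.2|) ij).
by rewrite !mxE ler_dist_dist.
Qed.

(** [rvabs] is not differentiable, so the chain rule does not apply.  Instead c
    is replaced by the ray z + tau u, where [rvabs_ray] is exact; the error is
    o(tau) because [rvabs] is 1-Lipschitz. *)
Lemma right_tangent_rvabs (s : nat) (c : R -> 'rV[R]_s) (z u : 'rV[R]_s) :
  right_tangent c z u ->
  right_tangent (@rvabs R s \o c) (rvabs z) (abs_dir_deriv z u).
Proof.
move=> cu; rewrite /right_tangent /=.
have -> : (fun tau => tau^-1 *: (rvabs (c tau) - rvabs z)) =
  (fun tau => tau^-1 *: (rvabs (z + tau *: u) - rvabs z) +
     tau^-1 *: (rvabs (c tau) - rvabs (z + tau *: u))).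
  apply/funext => tau; rewrite -scalerDr; congr (_ *: _).
  by rewrite [RHS]addrC addrA subrK.
rewrite -[X in _ --> X]addr0; apply: cvgD.
  apply: cvg_near_cst; near=> tau.
  have -> : rvabs (z + tau *: u) - rvabs z = tau *: abs_dir_deriv z u.
    by near: tau; exact: rvabs_ray.
  by rewrite scalerA mulVf ?scale1r// gt_eqF.
have cu0 : `|tau^-1 *: (c tau - z) - u| @[tau --> (0:R)^'+] --> (0:R).
  rewrite -[X in _ --> X](_ : `|u - u| = 0); last by rewrite subrr normr0.
  by apply: cvg_norm; apply: cvgB; [exact: cu|exact: cvg_cst].
apply: norm_cvg0; apply: squeeze_cvgr cu0; last exact: cvg_cst.
near=> tau.
have t0 : 0 < tau by [].
rewrite normr_ge0 /=.
have -> : tau^-1 *: (c tau - z) - u = tau^-1 *: (c tau - (z + tau *: u)).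
  by rewrite opprD addrA [RHS]scalerBr scalerA mulVf ?scale1r// gt_eqF.
by rewrite !normrZ ler_wpM2l// ler_dist_rvabs.
Unshelve. all: by end_near. Qed.

End RightTangent.

(** * Total and partial derivatives *)

Section PartialDerivatives.
Context (R : realType).

Lemma diff_pair_split (U V W : normedModType R) (G : U * V -> W)
    (x : U) (y : V) (h : U) (k : V) :
  differentiable G (x, y) ->
  'd G (x, y) (h, k) =
  'd (fun t => G (t, y)) x h + 'd (fun t => G (x, t)) y k.
Proof.
move=> dG.
have -> : 'd (fun t => G (t, y)) x h = 'd G (x, y) (h, 0).
  have dp : differentiable (fun t : U => (t, y)) x.
    exact: differentiable_pair.
  rewrite [LHS](congr1 (fun g => g h)
    (@diff_comp _ _ _ _ (fun t => (t, y)) G x dp dG)) /=.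
  rewrite diff_pair//= diff_cst (@diff_lin _ _ _ idfun)//.
  by move=> z; exact: cvg_id.
have -> : 'd (fun t => G (x, t)) y k = 'd G (x, y) (0, k).
  have dp : differentiable (fun t : V => (x, t)) y.
    exact: differentiable_pair.
  rewrite [LHS](congr1 (fun g => g k)
    (@diff_comp _ _ _ _ (fun t => (x, t)) G y dp dG)) /=.
  rewrite diff_pair//= diff_cst (@diff_lin _ _ _ idfun)//.
  by move=> z; exact: cvg_id.
by rewrite -linearD /= /GRing.add /= /add_pair /= addr0 add0r.
Qed.

Lemma differentiable_pairl (U V W : normedModType R) (G : U * V -> W) x y :
  differentiable G (x, y) -> differentiable (fun t => G (t, y)) x.
Proof.
move=> dG; apply: (@differentiable_comp _ _ _ _ (fun t => (t, y)) G).
  exact: differentiable_pair.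
exact: dG.
Qed.

Lemma differentiable_pairr (U V W : normedModType R) (G : U * V -> W) x y :
  differentiable G (x, y) -> differentiable (fun t => G (x, t)) y.
Proof.
move=> dG; apply: (@differentiable_comp _ _ _ _ (fun t => (x, t)) G).
  exact: differentiable_pair.
exact: dG.
Qed.

Lemma diff_jacobian (m k : nat) (G : 'rV[R]_m -> 'rV[R]_k) x h :
  differentiable G x -> 'd G x h = h *m 'J G x.
Proof. by move=> dG; rewrite -deriveE// deriveEjacobian. Qed.

Lemma diff_grad (m : nat) (g : 'rV[R]_m -> R) x h :
  differentiable g x -> 'd g x h = (h *m grad g x) ord0 ord0.
Proof.
move=> dg; rewrite mxE {1}(row_sum_delta h) linear_sum.
by apply: eq_bigr => i _; rewrite mxE linearZ deriveE.
Qed.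

End PartialDerivatives.

(** * First-order expansion of an abs-smooth form along a ray *)

Section AbsLinearizationExpansion.
Context (R : realType) (d n s : nat) (f : 'rV[R]_n -> R)
  (F : 'rV[R]_n * 'rV[R]_s * 'rV[R]_s -> 'rV[R]_s)
  (phi : 'rV[R]_n * 'rV[R]_s -> R).

(** Successive substitution into z = F(x, z, |z|).  Only finitely many
    compositions with F and [rvabs] are involved, so one-sided tangents
    propagate through it, which is not apparent from the implicit definition of
    [switching]. *)
Fixpoint switching_iter (z0 : 'rV[R]_s) (k : nat) (x : 'rV[R]_n) : 'rV[R]_s :=
  if k is k'.+1 then
    F (x, switching_iter z0 k' x, rvabs (switching_iter z0 k' x))
  else z0.

(** Each substitution makes one more coordinate final, since coordinate i of F
    reads only the coordinates below i; so s of them suffice from any start. *)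
Lemma switching_iterE z0 x :
  strictly_triangular F -> switching_iter z0 s x = switching F x.
Proof.
move=> FT; have [zE _] := switchingP x FT.
have agree k (i : 'I_s) : (i < k)%N ->
    switching_iter z0 k x ord0 i = switching F x ord0 i.
  elim: k i => // k IH i ik /=; rewrite zE; apply: FT => j ji.
  have jk : (j < k)%N by exact: leq_trans ji ik.
  by rewrite !mxE IH.
by apply/rowP => i; exact: agree.
Qed.

Lemma right_tangent_switching xbar h :
  strictly_triangular F -> (forall p, differentiable F p) ->
  exists u, right_tangent (fun tau => switching F (xbar + tau *: h))
    (switching F xbar) u.
Proof.
move=> FT dF; set zbar := switching F xbar.
have [zE _] := switchingP xbar FT.
(* Started at zbar, which solves the equation at xbar, all the iterates are
   curves based at zbar. *)
have iter_tangent k : exists u, right_tangent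
    (fun tau => switching_iter zbar k (xbar + tau *: h)) zbar u.
  elim: k => [|k [u IH]] /=.
    exists 0; rewrite /right_tangent.
    by apply: cvg_near_cst; near=> tau; rewrite subrr scaler0.
  exists ('d F (xbar, zbar, rvabs zbar) (h, u, abs_dir_deriv zbar u)).
  rewrite [X in right_tangent _ X]zE.
  apply: (right_tangent_comp (dF _)).
  apply: right_tangent_pair; last exact: right_tangent_rvabs IH.
  by apply: right_tangent_pair IH; exact: right_tangent_affine.
have [u Hu] := iter_tangent s.
exists u; move: Hu; congr (right_tangent _ _ _).
by apply/funext => tau; exact: switching_iterE.
Unshelve. all: by end_near. Qed.

Lemma diff_form_jacobian xbar h u w :
  (forall p, differentiable F p) ->
  'd F (xbar, switching F xbar, rvabs (switching F xbar)) (h, u, w) =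
  h *m Zmat F xbar + u *m Mmat F xbar + w *m Lmat F xbar.
Proof.
move=> dF; rewrite (@diff_pair_split _ _ _ _ F)//.
have dFp := differentiable_pairl (dF (xbar, switching F xbar,
  rvabs (switching F xbar))).
rewrite (@diff_pair_split _ _ _ _
  (fun q => F (q, rvabs (switching F xbar))))//.
congr (_ + _ + _).
- exact: diff_jacobian (differentiable_pairl dFp).
- exact: diff_jacobian (differentiable_pairr dFp).
- exact: diff_jacobian (differentiable_pairr (dF _)).
Qed.

(** The common number D is f'(xbar; h).  The same tangent u of the switching
    vector yields both halves: it gives the derivative of f by the chain rule
    through phi, and tau u solves the equation of Delta z(tau h). *)
Lemma abs_linearization_ray xbar h :
  (0 < d)%N -> abs_smooth_form d f F phi ->
  exists D, diff_quot f xbar h tau @[tau --> 0^'+] --> D /\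
    \forall tau \near 0^'+, delta_f F phi xbar (tau *: h) = tau * D.
Proof.
move=> d0 form.
have [dF dphi] : (forall p, differentiable F p) /\
    (forall p, differentiable phi p).
  by case: d d0 form => // d' _ [[dF _] [dphi _] _ _].
have [_ _ FT fE] := form.
set zbar := switching F xbar.
have [u Hu] := right_tangent_switching xbar h FT dF.
pose sig := abs_dir_deriv zbar u.
have xray := @right_tangent_affine R _ xbar h.
(* Both sides are tangents of z(xbar + tau h): the right one is obtained by
   differentiating F(x, z, |z|) along the ray. *)
have uE : u = h *m Zmat F xbar + u *m Mmat F xbar + sig *m Lmat F xbar.
  rewrite -diff_form_jacobian//.
  apply: (right_tangent_unique Hu).
  have [zE _] := switchingP xbar FT.
  have := right_tangent_comp (dF _)
    (right_tangent_pair (right_tangent_pair xray Hu) (right_tangent_rvabs Hu)).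
  rewrite /= -zE; congr (right_tangent _ _ _); apply/funext => tau /=.
  by have [<- _] := switchingP (xbar + tau *: h) FT.
exists ('d phi (xbar, zbar) (h, u)); split.
  have := right_tangent_comp (dphi _) (right_tangent_pair xray Hu).
  suff -> : diff_quot f xbar h = fun tau => tau^-1 *:
    ((phi \o (fun t => (xbar + t *: h, switching F (xbar + t *: h)))) tau
     - phi (xbar, zbar)) by [].
  by apply/funext => tau; rewrite /diff_quot !fE mulrC.
near=> tau.
have dzE : delta_z F xbar (tau *: h) = tau *: u.
  have [_ uniq] := delta_zP xbar (tau *: h) d0 form.
  apply/esym/uniq; rewrite /delta_z_rhs.
  have -> : rvabs (zbar + tau *: u) - rvabs zbar = tau *: sig.
    by near: tau; exact: rvabs_ray.
  by rewrite -!scalemxAl -!scalerDr -uE.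
rewrite /delta_f dzE -!scalemxAl -scalerDr mxE; congr (_ * _).
rewrite mxE (@diff_pair_split _ _ _ _ phi)//; congr (_ + _); apply/esym.
- exact: diff_grad (differentiable_pairl (dphi _)).
- exact: diff_grad (differentiable_pairr (dphi _)).
Unshelve. all: by end_near. Qed.

End AbsLinearizationExpansion.

(** * Minimality over a convex set *)

Lemma convex_set_ray (R : realType) (V : lmodType R) (C : set V) (x v : V)
    (t : R) :
  convex_set C -> C x -> C v -> 0 <= t -> t <= 1 -> C (x + t *: (v - x)).
Proof.
move=> cC Cx Cv t0 t1.
have t01 : Itv.spec (@Itv.num_sem R) (Itv.Real `[0%Z, 1%Z]) t.
  by rewrite /= /Itv.num_sem /= ger0_real//= in_itv /= t0 t1.
have := cC v x (Itv.mk t01); rewrite !inE => /(_ Cv Cx).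
rewrite /conv /=; congr (C _).
by rewrite scalerBl scale1r scalerBr addrCA.
Qed.

(** Nonnegativity for one scale alpha suffices: by convexity v may be pulled
    towards xbar until the step is short enough for [abs_linearization_ray]. *)
Lemma first_order_minimal_of_delta_f_ge0 (R : realType) (d n s : nat)
    (C : set 'rV[R]_n) (xbar : 'rV[R]_n) (alpha : R) (f : 'rV[R]_n -> R)
    (F : 'rV[R]_n * 'rV[R]_s * 'rV[R]_s -> 'rV[R]_s)
    (phi : 'rV[R]_n * 'rV[R]_s -> R) :
  (0 < d)%N -> convex_set C -> C xbar -> 0 < alpha ->
  abs_smooth_form d f F phi ->
  (forall v, C v -> 0 <= delta_f F phi xbar (alpha *: (v - xbar))) ->
  first_order_minimal f C xbar.
Proof.
move=> d0 cC Cx a0 form ge0 v Cv.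
have [D [fD dfE]] := abs_linearization_ray xbar (v - xbar) d0 form.
split; first by apply/cvg_ex; exists D.
rewrite /dir_deriv (cvg_lim _ fD)//.
near (0 : R)^'+ => tau.
have t0 : 0 < tau by [].
have dE : delta_f F phi xbar (tau *: (v - xbar)) = tau * D by near: tau.
have ta0 : 0 <= tau / alpha by rewrite divr_ge0// ltW.
have ta1 : tau / alpha <= 1.
  by rewrite ler_pdivrMr// mul1r; near: tau; exact: nbhs_right_le.
rewrite -(pmulr_rge0 _ t0) -dE.
have := ge0 _ (convex_set_ray cC Cx Cv ta0 ta1).
by rewrite addrC addKr scalerA mulrCA mulfV ?gt_eqF// mulr1.
Unshelve. all: by end_near. Qed.

Unset Implicit Arguments.

Theorem theorem2p1 (R : realType) (d n s : nat)
    (C : set 'rV[R]_n) (xbar : 'rV[R]_n) (alpha : R) (f : 'rV[R]_n -> R)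
    (F : 'rV[R]_n * 'rV[R]_s * 'rV[R]_s -> 'rV[R]_s)
    (phi : 'rV[R]_n * 'rV[R]_s -> R)
    (d_ge1 : (1 <= d)%N)
    (C_neq0 : C !=set0) (C_convex : convex_set C) (C_xbar : C xbar)
    (alpha_gt0 : 0 < alpha) (alpha_le1 : alpha <= 1)
    (f_Cabs : Cabs d f) (f_form : abs_smooth_form d f F phi) :
  (is_max_over C
     (fun v => - delta_f F phi xbar (alpha *: (v - xbar)) / alpha) 0 ->
   first_order_minimal f C xbar) /\
  (is_min_over C (fun v => delta_f F phi xbar (v - xbar)) 0 ->
   first_order_minimal f C xbar).
Proof.
split.
- move=> [_ ub]; apply: (first_order_minimal_of_delta_f_ge0 d_ge1 C_convex
    C_xbar alpha_gt0 f_form) => v Cv.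
  have := ub _ (ex_intro2 _ _ v Cv erefl).
  by rewrite mulNr oppr_le0 pmulr_lge0// invr_gt0.
- move=> [_ lb]; apply: (first_order_minimal_of_delta_f_ge0 d_ge1 C_convex
    C_xbar ltr01 f_form) => v Cv.
  by rewrite scale1r; exact: lb (ex_intro2 _ _ v Cv erefl).
Qed.
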